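(* For any uniform dessin d'enfant $\mathscr{D}$ of genus $1$, the automorphism group satisfies $\mathrm{Aut}\,\mathscr{D}\not\cong\{1\}$.
   Context: A dessin d'enfant (dessin) is a connected, finite, bipartite graph (vertices colored black and white, each edge joining a black vertex to a white vertex) embedded as a map in a connected, compact, oriented surface without boundary, so that every face is homeomorphic to a disk. Let $E$ be its set of edges and $n=|E|$. Let $x$ (resp. $y$) be the permutation of $E$ sending each edge $e$ to the next edge counterclockwise around the unique black (resp. white) vertex incident to $e$. The monodromy group is $G=\langle x,y\rangle\le \mathrm{Sym}(E)$; it acts transitively on $E$. Permutations act on the left and are composed from right to left. The cycles of $x$, $y$ and $(xy)^{-1}$ correspond to the black vertices, white vertices and faces, and the cycle lengths are their valencies. Conversely, any pair of permutations $x,y$ of an $n$-element set generating a transitive group arises in this way from a dessin. The passport of a dessin with $n$ edges is the triple $[\lambda_0,\lambda_1,\lambda_\infty]$ of partitions of $n$ given by the valencies of black vertices, white vertices and faces (equivalently the cycle types of $x$, $y$, $(xy)^{-1}$). The genus of the dessin is $g=\frac{n-(l(\lambda_0)+l(\lambda_1)+l(\lambda_\infty))}{2}+1$, where $l(\lambda)$ is the number of parts of $\lambda$. With $a^{p}$ denoting the partition with $p$ parts all equal to $a$, a dessin is uniform if its passport has the form $[a^{p},b^{q},c^{r}]$ with $n=pa=qb=rc$. The automorphism group $\mathrm{Aut}\,\mathscr{D}$ is the centralizer $C_{\mathrm{Sym}(E)}(G)=\{c\in \mathrm{Sym}(E)\mid cx=xc,\ cy=yc\}$. *)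

(* Defs.v *)
From mathcomp Require Import all_boot all_order all_fingroup all_algebra.

Set Implicit Arguments.
Unset Strict Implicit.
Unset Printing Implicit Defensive.

Import GroupScope.

(* A dessin is given by the rotations [x], [y] of its edges around the black
   and the white vertices; connectedness of the graph is transitivity of the
   group they generate.  [transitive _, on S | _] entails that S is nonempty,
   so a dessin has at least one edge. *)
Record dessin := Dessin {
  edge : finType;
  rot_black : {perm edge};
  rot_white : {perm edge};
  dessin_connected :
    [transitive <<[set rot_black; rot_white]>>, on [set: edge] | 'P]
}.

Definition nb_edges (D : dessin) : nat := #|edge D|.

Definition monodromy_group (D : dessin) : {group {perm edge D}} :=
  <<[set rot_black D; rot_white D]>>%G.

(* The face permutation is (xy)^-1 with xy composed from right to left.
   Products in {perm _} are composed from left to right, hence y * x here. *)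
Definition rot_face (D : dessin) : {perm edge D} :=
  (rot_white D * rot_black D)^-1.

(* Partitions are nonincreasing lists of parts; fixed points of the
   permutation contribute parts equal to 1. *)
Definition cycle_type (T : finType) (s : {perm T}) : seq nat :=
  sort geq [seq #|C| | C : {set T} in porbits s].

Definition passport (D : dessin) : seq nat * seq nat * seq nat :=
  (cycle_type (rot_black D), cycle_type (rot_white D),
   cycle_type (rot_face D)).

Definition genus (D : dessin) : rat :=
  let: (l0, l1, loo) := passport D in
  (((nb_edges D)%:R - (size l0 + size l1 + size loo)%N%:R) / 2%:R + 1)%R.

Definition uniform (D : dessin) : Prop :=
  exists a b c p q r : nat,
    [/\ passport D = (nseq p a, nseq q b, nseq r c),
        nb_edges D = (p * a)%N,
        nb_edges D = (q * b)%N
      & nb_edges D = (r * c)%N].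

Definition dessin_aut (D : dessin) : {group {perm edge D}} :=
  'C(monodromy_group D)%G.

(* Main.v *)
Require Import Defs.
From mathcomp Require Import all_boot all_order all_fingroup all_algebra.
From mathcomp Require Import zify.

Import GroupScope.

(* A uniform dessin of genus 1 has valencies (3,3,3), (2,4,4) or (2,3,6) up to
   order, so its monodromy group is a quotient of a Euclidean triangle group.
   The image N of the translations is abelian, and every element outside N has
   a power conjugate to a nontrivial power of x, y or (xy)^-1, which by
   uniformity fixes no edge.  Hence every edge stabiliser lies in N.  Some
   t <> 1 thus commutes with all edge stabilisers (any t in N \ 1, or any t at
   all if N = 1), and for t e0 <> e0 the map g e0 |-> g (t e0) is a nontrivial
   automorphism. *)

(** * Arithmetic of the valencies *)

(** Dividing [n = p + q + r] by [n] gives 1/a + 1/b + 1/c = 1. The largest term 1/a is at least 1/3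
    and below 1, so [a] is 2 or 3; [b] is then bounded likewise. *)
Lemma sorted_euclidean_triples (n p q r a b c : nat) :
  (0 < n -> n = p * a -> n = q * b -> n = r * c -> n = p + q + r ->
  a <= b -> b <= c ->
  [\/ [/\ a = 3, b = 3 & c = 3], [/\ a = 2, b = 4 & c = 4]
    | [/\ a = 2, b = 3 & c = 6]])%N.
Proof.
move=> n_gt0 na nb nc nE ab bc.
have /andP[p_gt0 a_gt0] : ((0 < p) && (0 < a))%N by rewrite -muln_gt0 -na.
have /andP[q_gt0 b_gt0] : ((0 < q) && (0 < b))%N by rewrite -muln_gt0 -nb.
have /andP[r_gt0 c_gt0] : ((0 < r) && (0 < c))%N by rewrite -muln_gt0 -nc.
have qp : (q <= p)%N by nia.
have rq : (r <= q)%N by nia.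
have a_le3 : (a <= 3)%N by nia.
have a_gt1 : (1 < a)%N by nia.
have [a2|a2] := eqVneq a 2; last first.
  have a3 : a = 3 by lia.
  subst a; have [? ?] : q = p /\ r = p by lia.
  by subst q r; constructor 1; split; nia.
subst a; have pE : p = (q + r)%N by lia.
subst p; have b_le4 : (b <= 4)%N by nia.
have b_gt2 : (2 < b)%N by nia.
have [b3|b3] := eqVneq b 3.
  subst b; have qE : q = (2 * r)%N by lia.
  by subst q; constructor 3; split; nia.
have b4 : b = 4 by lia.
subst b; have qE : q = r by lia.
by subst q; constructor 2; split; nia.
Qed.

(** * Elements with fixed points in groups of translations and rotations *)

Section Fixers.

(* [F g] is to be read as [g has a fixed point]. *)
Variables (gT : finGroupType) (F : pred gT).
Hypothesis FX : forall g k, F g -> F (g ^+ k).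
Hypothesis FJ : forall g h, F g -> F (g ^ h).

Lemma FJE g h : F (g ^ h) = F g.
Proof.
apply/idP/idP; last exact: FJ.
by move/(FJ _ h^-1); rewrite conjgK.
Qed.

Lemma FVE g : F g^-1 = F g.
Proof.
have FV h : F h -> F h^-1 by rewrite invg_expg; apply: FX.
by apply/idP/idP => /FV; rewrite ?invgK.
Qed.

Lemma FMC g h : F (g * h) = F (h * g).
Proof. by rewrite -(FJE (g * h) g) conjgE mulgA mulKg. Qed.

Lemma cycle_join_abelian (u w : gT) : commute u w -> abelian (<[u]> <*> <[w]>).
Proof.
move=> cuw; rewrite abelianY !cycle_abelian /= cycle_subG.
by apply/centP => _ /cycleP[i ->]; apply/commuteX/commute_sym.
Qed.

Lemma mem_cycle_join (u w n : gT) : commute u w -> n \in <[u]> <*> <[w]> ->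
  exists i j, n = u ^+ i * w ^+ j.
Proof.
move=> cuw; rewrite cent_joinEr; last first.
  by rewrite cycle_subG; apply/centP => _ /cycleP[i ->]; apply/commuteX/commute_sym.
by case/mulsgP=> _ _ /cycleP[i ->] /cycleP[j ->] ->; exists i, j.
Qed.

(* Conjugation by a translation [m] changes [n] by [m ^+ 2], so only the class of
   [n] modulo squares matters. *)
Lemma half_turns (u w s n : gT) :
  commute u w -> u ^ s = u^-1 -> w ^ s = w^-1 ->
  ~~ F s -> ~~ F (u * s) -> ~~ F (w * s) -> ~~ F (u * w * s) ->
  n \in <[u]> <*> <[w]> -> ~~ F (n * s).
Proof.
move=> cuw us ws Fs Fus Fws Fuws /(mem_cycle_join _ _ _ cuw)[i [j ->]].
(* Halving the exponents gives [u ^+ i * w ^+ j = m * g * m]; since [s] inverts [m], [m * g * m * s]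
   is conjugate to [g * s]. *)
set m := u ^+ (i %/ 2) * w ^+ (j %/ 2).
set g := u ^+ (i %% 2) * w ^+ (j %% 2).
have cX k l : commute (w ^+ l) (u ^+ k).
  exact/commuteX/commute_sym/commuteX.
have ms : m ^ s = m^-1.
  by rewrite conjMg !conjXg us ws !expgVn -invMg cX.
have cgm : commute g m.
  apply: commuteM; apply: commute_sym; apply: commuteM.
  - exact/commuteX/commute_sym/commuteX.
  - exact/commute_sym/cX.
  - exact: cX.
  - exact/commuteX/commute_sym/commuteX.
have mulX k l k' l' : u ^+ k * w ^+ l * (u ^+ k' * w ^+ l') =
    u ^+ (k + k') * w ^+ (l + l').
  by rewrite !expgD -!mulgA; congr (_ * _); rewrite !mulgA cX.
have -> : u ^+ i * w ^+ j = m * g * m.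
  rewrite /m /g !mulX; congr (u ^+ _ * w ^+ _).
    by rewrite [LHS](divn_eq i 2); lia.
  by rewrite [LHS](divn_eq j 2); lia.
have -> : m * g * m * s = (g * s) ^ m^-1.
  by rewrite conjgE invgK -(mulgA _ m s) [m * s]conjgC ms !mulgA.
rewrite FJE /g; have := ltn_pmod j (isT : 0 < 2)%N.
have := ltn_pmod i (isT : 0 < 2)%N.
by case: (i %% 2)%N => [|[|//]] _; case: (j %% 2)%N => [|[|//]] _;
  rewrite ?mul1g ?mulg1.
Qed.

(* Conjugation by translations identifies [w] with [u] and kills [u ^+ 3], so
   only the exponent of [u] modulo 3 matters. *)
Lemma third_turns (u w s n : gT) :
  commute u w -> u ^ s = w -> w ^ s = u^-1 * w^-1 ->
  ~~ F s -> ~~ F (u * s) -> ~~ F (u^-1 * s) ->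
  n \in <[u]> <*> <[w]> -> ~~ F (n * s).
Proof.
move=> cuw us ws Fs Fus Fus' /(mem_cycle_join _ _ _ cuw)[i [j ->]].
have cX k l : commute (w ^+ l) (u ^+ k).
  exact/commuteX/commute_sym/commuteX.
(* Cycle [m ^ s] to the right end, then use [s * m ^ s = m * s]. *)
have shift m g : F (m ^ s * g * s) = F (g * m * s).
  by rewrite -mulgA FMC -!mulgA -conjgC mulgA.
have drop_w k l : F (u ^+ k * w ^+ l * s) = F (u ^+ (k + l) * s).
  by rewrite -cX -us -conjXg shift -expgD.
have drop_u3 k : F (u ^+ k.+3 * s) = F (u ^+ k * s).
  have cwu : w * u ^+ k.+1 = u ^+ k.+1 * w by apply: (cX _ 1%N).
  have := shift w (w * u ^+ k.+1).
  rewrite ws !mulgA mulgKV cwu -(mulgA _ w w) (drop_w _ 2%N) addn2 => <-.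
  by rewrite expgS mulKg.
have drop_u2 : F (u ^+ 2 * s) = F (u^-1 * s).
  by have := shift w w; rewrite ws mulgKV -(mul1g (w * w)) (drop_w 0%N 2%N).
rewrite drop_w (divn_eq (i + j) 3); elim: (_ %/ 3)%N => [|k IHk]; last first.
  by rewrite mulSn -addnA drop_u3.
have := ltn_pmod (i + j) (isT : 0 < 3)%N; rewrite add0n.
by case: (_ %% 3)%N => [|[|[|//]]] _; rewrite ?mul1g ?drop_u2.
Qed.

(* The exponent [k] selects a power of the rotation [n * z ^+ i] whose angle is
   a half or a third of a turn. *)
Lemma fixers_translation (N : {group gT}) z d g :
  (0 < d)%N -> z ^+ d = 1 -> z \in 'N(N) ->
  (forall i, (0 < i < d)%N ->
     exists k, {in N, forall n, ~~ F (n * z ^+ (i * k))}) ->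
  g \in N * <[z]> -> F g -> g \in N.
Proof.
move=> d_gt0 zd nNz rot /mulsgP[n _ Nn /cycleP[i ->] ->].
rewrite -(expg_mod i zd); case: (posnP (i %% d)) => [-> _|i_gt0].
  by rewrite mulg1.
have [|k rotk] := rot (i %% d)%N; first by rewrite i_gt0 ltn_pmod.
move/(FX _ k) => Fg.
have [n' Nn' gE] : exists2 n', n' \in N &
    (n * z ^+ (i %% d)) ^+ k = n' * z ^+ (i %% d * k).
  elim: k {rotk Fg} => [|k [n' Nn' IHk]].
    by exists 1; rewrite ?muln0 ?mulg1.
  set t := z ^+ (i %% d).
  exists (n' * n ^ (t ^+ k)^-1).
    by rewrite groupM // memJ_norm // groupV !groupX.
  rewrite expgSr IHk mulnS addnC expgD [z ^+ (_ * _)]expgM -/t.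
  by rewrite conjgE invgK !mulgA mulgKV.
by rewrite gE (negPf (rotk _ Nn')) in Fg.
Qed.

Definition free_of_order a (x : gT) :=
  x ^+ a = 1 /\ forall i, (0 < i < a)%N -> ~~ F (x ^+ i).

(** Such [x], [y], [z] generate a quotient of the (a, b, c) triangle group; [N] will be the image of
    its translations. *)
Definition abelian_fixers a b c := forall x y z : gT,
  x * y * z = 1 ->
  free_of_order a x -> free_of_order b y -> free_of_order c z ->
  exists N : {group gT}, abelian N /\
    {in <<[set x; y; z]>>, forall g, F g -> g \in N}.

Lemma free_of_orderV a x : free_of_order a x -> free_of_order a x^-1.
Proof.
case=> xa Fx; split=> [|i /Fx]; first by rewrite expgVn xa invg1.
by rewrite expgVn FVE.
Qed.

(** Conjugating [x * y * z = 1] by [z^-1] gives [z * x * y = 1]. *)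
Lemma abelian_fixers_rot a b c : abelian_fixers a b c -> abelian_fixers b c a.
Proof.
move=> fix_abc x y z xyz xb yc za.
have [|N [abN fixN]] := fix_abc z x y _ za xb yc.
  by rewrite -[RHS](conj1g z^-1) -xyz conjgE invgK !mulgA mulgK.
by exists N; split=> // g; rewrite -[_ :|: [set z]]setUC setUA; apply: fixN.
Qed.

(** Inverting [x * y * z = 1] reverses the factors, and inverses keep their free orders. *)
Lemma abelian_fixers_rev a b c : abelian_fixers a b c -> abelian_fixers c b a.
Proof.
move=> fix_abc x y z xyz xc yb za.
have [|N [abN fixN]] := fix_abc z^-1 y^-1 x^-1 _ (free_of_orderV _ _ za)
  (free_of_orderV _ _ yb) (free_of_orderV _ _ xc).
  by rewrite -!invMg mulgA xyz invg1.
exists N; split=> // g Gg; apply: fixN; apply: subsetP Gg.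
rewrite gen_subG !subUset !sub1set.
by rewrite -(groupV _ x) -(groupV _ y) -(groupV _ z) !mem_gen // !inE eqxx ?orbT.
Qed.

(** [z] normalises the translations [<[u]> <*> <[w]>] and [x] is a translation times a power of [z],
    so the whole group consists of such products and [fixers_translation] applies. *)
Lemma abelian_fixers_intro (u w x y z : gT) d j :
  x * y * z = 1 -> x = u * z ^+ j -> (0 < d)%N -> z ^+ d = 1 -> commute u w ->
  u ^ z \in <[u]> <*> <[w]> -> w ^ z \in <[u]> <*> <[w]> ->
  (forall i, (0 < i < d)%N -> exists k,
     {in <[u]> <*> <[w]>, forall n, ~~ F (n * z ^+ (i * k))}) ->
  exists N : {group gT}, abelian N /\
    {in <<[set x; y; z]>>, forall g, F g -> g \in N}.
Proof.
move=> xyz xE d_gt0 zd cuw uz wz rot.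
have nz : z \in 'N(<[u]> <*> <[w]>).
  by rewrite inE conjYg join_subG -!cycleJ !cycle_subG uz wz.
exists (<[u]> <*> <[w]>)%G; split; first exact: cycle_join_abelian.
move=> g Gg; apply: (fixers_translation _ _ _ _ d_gt0 zd nz rot).
suff /subsetP: <<[set x; y; z]>> \subset (<[u]> <*> <[w]>) * <[z]> by apply.
rewrite -norm_joinEr ?cycle_subG // gen_subG !subUset !sub1set.
have zG : z \in <[u]> <*> <[w]> <*> <[z]>.
  by rewrite mem_gen // inE cycle_id orbT.
have uG : u \in <[u]> <*> <[w]> <*> <[z]>.
  by rewrite -joingA mem_gen // inE cycle_id.
have xG : x \in <[u]> <*> <[w]> <*> <[z]> by rewrite xE groupM ?groupX.
by rewrite xG zG -(groupMl _ xG) -(groupMr _ zG) xyz group1.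
Qed.

(** * The three Euclidean triangle groups *)

Lemma mulg3_eq1 (x y z : gT) : x * y * z = 1 -> y = x^-1 * z^-1.
Proof.
by move=> xyz; apply: (canRL (mulKg x)); rewrite (canRL (mulgK z) xyz) mul1g.
Qed.

Lemma expg_complement (g : gT) a i j : g ^+ a = 1 -> (i + j)%N = a ->
  g ^+ i = g^-1 ^+ j.
Proof.
by move=> ga ij; apply: (mulIg (g ^+ j)); rewrite -expgD ij ga expgVn mulVg.
Qed.

Ltac words := rewrite ?(conjgE, expgS, expg0, mulg1, mul1g, invMg, invgK, invg1,
  mulgA, mulgK, mulgKV, mulgV, mulVg).

Lemma abelian_fixers_333 : abelian_fixers 3 3 3.
Proof.
move=> x y z xyz [x3 Fx] [y3 Fy] [z3 Fz].
have yE := mulg3_eq1 _ _ _ xyz.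
have xx : x * x = x^-1 := expg_complement _ _ 2%N 1%N x3 erefl.
have xVxV : x^-1 * x^-1 = x := esym (expg_complement _ _ 1%N 2%N x3 erefl).
have zz : z * z = z^-1 := expg_complement _ _ 2%N 1%N z3 erefl.
have zVzV : z^-1 * z^-1 = z := esym (expg_complement _ _ 1%N 2%N z3 erefl).
(* The relation [y ^+ 3 = 1] in terms of [x] and [z]. *)
have xzx : x * z * x = z^-1 * x^-1 * z^-1.
  move: (expg_complement _ _ 2%N 1%N y3 erefl); rewrite yE.
  by move/(congr1 invg); words => hy; apply: (mulgI z); words.
(* In the triangle group [x] and [z] rotate by the same third of a turn, so [u] is a translation. *)
pose u := x * z^-1; pose w := u ^ z.
have wE : w = z^-1 * x by rewrite /w /u; words.
have cuw : commute u w.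
  rewrite /commute wE /u; words; rewrite -(mulgA x) zVzV xzx.
  by rewrite -(mulgA _ x x) xx.
have ws : w ^ z = u^-1 * w^-1.
  rewrite wE /u; words; rewrite zVzV.
  by rewrite -(mulgA _ x^-1 x^-1) xVxV.
(* The representatives [z], [u * z], [u^-1 * z] are [z], [x] and a conjugate of [y]. *)
have FN n : n \in <[u]> <*> <[w]> -> ~~ F (n * z).
  apply: third_turns => //; first exact: (Fz 1%N).
    by rewrite /u mulgKV; apply: (Fx 1%N).
  rewrite /u invMg invgK FMC mulgA zz FMC -yE.
  exact: (Fy 1%N).
apply: (abelian_fixers_intro u w x y z 3 1) => //.
- by rewrite /u mulgKV.
- by rewrite mem_gen // inE cycle_id orbT.
- by rewrite ws groupM ?groupV ?mem_gen // inE cycle_id ?orbT.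
case=> [|[|[|//]]] // _; first by exists 1%N.
by exists 2%N => n Nn; rewrite -(expg_mod _ z3); apply: FN.
Qed.

Lemma abelian_fixers_244 : abelian_fixers 2 4 4.
Proof.
move=> x y z xyz [x2 Fx] [y4 Fy] [z4 Fz].
have yE := mulg3_eq1 _ _ _ xyz.
have xV : x^-1 = x := esym (expg_complement _ _ 1%N 1%N x2 erefl).
have zVzV : z^-1 * z^-1 = z * z := esym (expg_complement _ _ 2%N 2%N z4 erefl).
have zzz t : t * z * z * z = t * z^-1.
  by rewrite -!mulgA; congr (t * _); apply: (expg_complement _ _ 3%N 1%N z4 erefl).
(* The relation [y ^+ 4 = 1], read as the equality of [y ^+ 2] and its inverse. *)
have hR : x * z^-1 * x * z^-1 = z * x * z * x.
  by have := (expg_complement _ _ 2%N 2%N y4 erefl); rewrite yE; words; rewrite xV.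
have xzx : x * z * x = z^-1 * x * z^-1 * x * z^-1.
  by apply: (mulgI z); words; rewrite -hR.
(* A product of two half turns is a translation. *)
pose u := x * z ^+ 2; pose w := u ^ z.
have wE : w = z^-1 * x * z^-1.
  by rewrite /w /u; words; rewrite zzz.
have cuw : commute u w.
  rewrite /commute wE /u; words; rewrite xzx.
  by rewrite -(mulgA _ z^-1 z^-1) zVzV; words.
have ws : w ^ z = u^-1 by rewrite wE /u; words; rewrite xV.
(* The four representatives are [z ^+ 2], [x], [x ^ z] and a conjugate of [y ^+ 2]. *)
have FN n : n \in <[u]> <*> <[w]> -> ~~ F (n * z ^+ 2).
  apply: half_turns => //.
  - by rewrite -ws /w -conjgM.
  - by rewrite expgS conjgM ws conjVg.
  - exact: (Fz 2%N).
  - by rewrite /u -mulgA -expgD z4 mulg1; apply: (Fx 1%N).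
  - have -> : w * z ^+ 2 = x ^ z by rewrite wE; words.
    by rewrite FJE; apply: (Fx 1%N).
  have -> : u * w * z ^+ 2 = x * z * x * z by rewrite wE /u; words.
  rewrite FMC mulgA mulgA -hR; have := Fy 2%N isT.
  by rewrite yE; words; rewrite xV.
apply: (abelian_fixers_intro u w x y z 4 2) => //.
- by rewrite /u -mulgA -expgD z4 mulg1.
- by rewrite mem_gen // inE cycle_id orbT.
- by rewrite ws groupV mem_gen // inE cycle_id.
(* In each case [i * k] is 2 modulo 4. *)
case=> [|[|[|[|//]]]] // _; [exists 2%N | exists 1%N | exists 2%N] => n Nn;
  by rewrite -(expg_mod _ z4); apply: FN.
Qed.

Lemma abelian_fixers_236 : abelian_fixers 2 3 6.
Proof.
move=> x y z xyz [x2 Fx] [y3 Fy] [z6 Fz].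
have yE := mulg3_eq1 _ _ _ xyz.
have xV : x^-1 = x := esym (expg_complement _ _ 1%N 1%N x2 erefl).
have zzz t : t * z * z * z = t * z^-1 * z^-1 * z^-1.
  have := expg_complement _ _ 3%N 3%N z6 erefl; words.
  by move/(congr1 (mulg t)); words.
(* The relation [y ^+ 3 = 1], with a prefix [t] so that it rewrites inside left-associated words. *)
have xzVx t : t * x * z^-1 * x = t * z * x * z.
  rewrite -!mulgA; congr (t * _); apply: (mulIg z^-1); rewrite -!mulgA mulgV mulg1.
  by have := (expg_complement _ _ 2%N 1%N y3 erefl); rewrite yE; words; rewrite xV.
have xzx : x * z * x = z^-1 * x * z^-1.
  by apply: invg_inj; words; rewrite xV -[x * _]mul1g !mulgA xzVx; words.
pose u := x * z ^+ 3; pose w := u ^ (z ^+ 2).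
have wE : w = z^-1 * z^-1 * x * z^-1.
  by rewrite /w /u; words; rewrite zzz; words.
have uw : u * w = z^-1 * x * z^-1 * z^-1.
  by rewrite wE /u; words; rewrite xzx.
have cuw : commute u w.
  by rewrite /commute uw wE /u; words; rewrite xzVx; words; rewrite zzz; words.
have uz : u ^ z = u * w.
  by rewrite uw /u; words; rewrite zzz; words.
have wz : w ^ z = u^-1.
  rewrite wE /u; words; by rewrite xV.
(* The half turns reduce to [z ^+ 3] and three conjugates of [x]. *)
have FN3 n : n \in <[u]> <*> <[w]> -> ~~ F (n * z ^+ 3).
  apply: half_turns => //.
  - by rewrite expgSr conjgM.
  - by rewrite expgS conjgM wz conjVg.
  - exact: (Fz 3%N).
  - by rewrite /u -mulgA -expgD z6 mulg1; apply: (Fx 1%N).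
  - have -> : w * z ^+ 3 = x ^ (z ^+ 2) by rewrite wE; words.
    by rewrite FJE; apply: (Fx 1%N).
  have -> : u * w * z ^+ 3 = x ^ z by rewrite uw; words.
  by rewrite FJE; apply: (Fx 1%N).
(* The third turns reduce to [z ^+ 2], [y] and [y ^ (z ^+ 3)]. *)
have FN2 n : n \in <[u]> <*> <[w]> -> ~~ F (n * z ^+ 2).
  apply: third_turns => //.
  - by rewrite expgS conjgM wz conjVg uz -invMg cuw.
  - exact: (Fz 2%N).
  - have -> : u * z ^+ 2 = y.
      by rewrite yE xV /u; words; rewrite zzz; words.
    exact: (Fy 1%N).
  have -> : u^-1 * z ^+ 2 = y ^ (z ^+ 3).
    by rewrite /u yE; words; rewrite xV.
  by rewrite FJE; apply: (Fy 1%N).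
apply: (abelian_fixers_intro u w x y z 6 3) => //.
- by rewrite /u -mulgA -expgD z6 mulg1.
- by rewrite uz groupM ?mem_gen // inE cycle_id ?orbT.
- by rewrite wz groupV mem_gen // inE cycle_id.
(* Modulo 6, [i * k] is 3 for [i = 3] and 2 otherwise. *)
case=> [|[|[|[|[|[|//]]]]]] // _;
  [exists 2%N | exists 1%N | exists 1%N | exists 2%N | exists 4%N] => n Nn;
  by rewrite -(expg_mod _ z6); [exact: FN2 || exact: FN3].
Qed.

End Fixers.

(** * Permutations: fixed points, centralisers and cycle types *)

Definition has_fixpoint {T : finType} (s : {perm T}) := [exists e, s e == e].

Lemma has_fixpointX (T : finType) (s : {perm T}) k :
  has_fixpoint s -> has_fixpoint (s ^+ k).
Proof.
case/existsP=> e /eqP se; apply/existsP; exists e.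
by elim: k => [|k /eqP IHk]; rewrite ?perm1 // expgSr permM IHk se.
Qed.

Lemma has_fixpointJ (T : finType) (s t : {perm T}) :
  has_fixpoint s -> has_fixpoint (s ^ t).
Proof.
by case/existsP=> e /eqP se; apply/existsP; exists (t e); rewrite permJ se.
Qed.

Lemma cent_transitive_neq1 (T : finType) (G : {group {perm T}}) (t : {perm T}) :
  [transitive G, on [set: T] | 'P] -> t != 1 ->
  {in G, forall g, has_fixpoint g -> commute g t} -> 'C(G) != 1.
Proof.
move=> trG t_neq1 cGt.
have [e0 te0] : exists e, t e != e.
  apply/existsP; apply: contraNT t_neq1; rewrite negb_exists => /forallP tid.
  by apply/eqP/permP=> e; rewrite perm1; apply/eqP; rewrite -[_ == _]negbK tid.
(* [e] and [t e] have the same stabiliser. Left to right this makes [c] below independent of the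
   chosen [g]; right to left it makes [c] injective. *)
have fixE g h e : g \in G -> h \in G -> (g e == h e) = (g (t e) == h (t e)).
  move=> Gg Gh.
  have GE f : (g f == h f) = ((g * h^-1) f == f).
    by rewrite permM (can2_eq (permKV h) (permK h)) eq_sym.
  have Ggh : g * h^-1 \in G by rewrite groupM ?groupV.
  rewrite !GE; apply/eqP/eqP => fixgh.
    have cgt : commute (g * h^-1) t.
      by apply: cGt Ggh _; apply/existsP; exists e; apply/eqP.
    by rewrite -permM -cgt permM fixgh.
  have cgt : commute (g * h^-1) t.
    by apply: cGt Ggh _; apply/existsP; exists (t e); apply/eqP.
  by apply: (@perm_inj _ t); rewrite -permM cgt permM fixgh.
have orbE e : {g | g \in G & g e0 == e}.
  apply: sig2W; have [g Gg ->] := atransP2 trG (in_setT e0) (in_setT e).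
  by exists g; rewrite // apermE.
pose c e := s2val (orbE e) (t e0).
have cE g : g \in G -> c (g e0) = g (t e0).
  move=> Gg; rewrite /c; case: (orbE _) => h Gh /= /eqP he0.
  by apply/eqP; rewrite -fixE // he0.
have c_inj : injective c.
  move=> e f; have [g Gg /eqP<-] := orbE e; have [h Gh /eqP<-] := orbE f.
  by rewrite !cE // => /eqP; rewrite -fixE // => /eqP.
have cC : perm c_inj \in 'C(G).
  apply/centP=> h Gh; apply/permP=> e; rewrite !permM !permE.
  have [g Gg /eqP<-] := orbE e.
  by rewrite -permM !cE ?groupM // permM.
apply: contraNneq te0 => C1; move: cC; rewrite C1 => /set1P/permP/(_ e0).
by rewrite permE perm1 -{1}[e0](perm1 e0) cE ?perm1 // => ->.
Qed.

(** This is how uniformity enters: each cycle of [s] visits [a] distinct points before returning. *)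
Lemma free_of_order_cycle_type (T : finType) (s : {perm T}) p a :
  cycle_type s = nseq p a -> free_of_order _ (@has_fixpoint T) a s.
Proof.
move=> sE; have card_orb e : #|porbit s e| = a.
  have : #|porbit s e| \in cycle_type s.
    rewrite mem_sort; apply/mapP; exists (porbit s e) => //.
    by rewrite mem_enum imset_f.
  by rewrite sE => /nseqP[].
split=> [|i /andP[i_gt0 i_lta]].
  by apply/permP=> e; rewrite permX -(card_orb e) iter_porbit perm1.
apply/existsP=> -[e /eqP]; rewrite permX => sie.
have a_gt0 := ltn_trans i_gt0 i_lta.
have := nth_uniq e _ _ (uniq_traject_porbit s e).
rewrite card_orb size_traject => /(_ 0%N i a_gt0 i_lta).
by rewrite !nth_traject //= sie eqxx; case: i i_gt0 {i_lta sie}.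
Qed.

(** The numerical constraints are symmetric, and [rot] and [rev] generate all reorderings of the
    triple, so the sorted case suffices. *)
Lemma abelian_fixers_euclidean (gT : finGroupType) (F : pred gT)
    (n p q r a b c : nat) :
  (forall g k, F g -> F (g ^+ k)) -> (forall g h, F g -> F (g ^ h)) ->
  (0 < n)%N -> n = (p * a)%N -> n = (q * b)%N -> n = (r * c)%N ->
  n = (p + q + r)%N -> abelian_fixers _ F a b c.
Proof.
move=> FX FJ.
have rot := abelian_fixers_rot _ F; have rev := abelian_fixers_rev _ F FX.
have sorted p' q' r' a' b' c' : (0 < n -> n = p' * a' -> n = q' * b' ->
    n = r' * c' -> n = p' + q' + r' -> a' <= b' -> b' <= c' ->
    abelian_fixers _ F a' b' c')%N.
  move=> n_gt0 na nb nc nE ab bc.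
  have [[-> -> ->]|[-> -> ->]|[-> -> ->]] :=
    sorted_euclidean_triples _ _ _ _ _ _ _ n_gt0 na nb nc nE ab bc.
  - exact: abelian_fixers_333.
  - exact: abelian_fixers_244.
  - exact: abelian_fixers_236.
move=> n_gt0 na nb nc nE.
have [ab|/ltnW ba] := leqP a b; have [bc|/ltnW cb] := leqP b c;
  have [ac|/ltnW ca] := leqP a c.
- exact: (sorted p q r).
- exact: (sorted p q r).
- by apply/rot/rot/rev; apply: (sorted p r q) => //; lia.
- by apply/rot; apply: (sorted r p q) => //; lia.
- by apply/rot/rev; apply: (sorted q p r) => //; lia.
- by apply/rot/rot; apply: (sorted q r p) => //; lia.
- by apply/rev; apply: (sorted r q p) => //; lia.
- by apply/rev; apply: (sorted r q p) => //; lia.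
Qed.

Theorem proposition5p2 (D : dessin) (uniD : uniform D)
  (genusD : genus D = 1%R) :
  ~~ (dessin_aut D \isog [1 {perm edge D}]).
Proof.
have [a [b [c [p [q [r [pE nE0 nE1 nEoo]]]]]]] := uniD.
have [l0E l1E looE] : [/\ cycle_type (rot_black D) = nseq p a,
  cycle_type (rot_white D) = nseq q b & cycle_type (rot_face D) = nseq r c].
  by case: pE.
have trG : [transitive monodromy_group D, on [set: edge D] | 'P].
  exact: dessin_connected.
have n_gt0 : (0 < nb_edges D)%N.
  by have [e _ _] := imsetP trG; apply/card_gt0P; exists e.
(* Genus 1 means that the numerator in [genus] vanishes. *)
have nE : nb_edges D = (p + q + r)%N.
  move: genusD; rewrite /genus pE !size_nseq -[X in _ = X]GRing.add0r.
  move/GRing.addIr/eqP; rewrite GRing.mulf_eq0 GRing.invr_eq0 orbF.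
  by rewrite GRing.subr_eq0 Num.Theory.eqr_nat => /eqP.
(* White precedes black because [rot_face] is the inverse of [rot_white D * rot_black D], which
   makes the relation an instance of [mulgV]. *)
have [|N [abN fixN]] := abelian_fixers_euclidean _ (@has_fixpoint (edge D))
  _ _ _ _ _ _ _ (@has_fixpointX _) (@has_fixpointJ _) n_gt0 nE1 nE0 nEoo _
  (rot_white D) (rot_black D) (rot_face D) (mulgV _)
  (free_of_order_cycle_type _ _ _ _ l1E) (free_of_order_cycle_type _ _ _ _ l0E)
  (free_of_order_cycle_type _ _ _ _ looE).
  by rewrite nE (addnC q p).
have GN : {in monodromy_group D, forall g, has_fixpoint g -> g \in N}.
  move=> g Gg; apply: fixN; apply: subsetP g Gg.
  by rewrite genS // (setUC [set rot_black D]) subsetUl.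
have [t t_neq1 tN] : exists2 t : {perm edge D}, t != 1 & t \in N \/ N :=: 1.
  have [N1|/trivgPn[t Nt t_neq1]] := eqVneq (N : {set _}) 1; last first.
    by exists t; last left.
  (* For trivial [N] any [t] other than 1 serves; a transposition exists since [p] and [q] are
     positive and hence there are at least two edges. *)
  have /card_gt1P[e [f [_ _ ef]]] : (1 < #|edge D|)%N.
    have p_gt0 : (0 < p)%N by move: n_gt0; rewrite nE0 muln_gt0 => /andP[].
    have q_gt0 : (0 < q)%N by move: n_gt0; rewrite nE1 muln_gt0 => /andP[].
    by rewrite -[#|_|]/(nb_edges D) nE -addnA (@leq_add 1 1) ?addn_gt0 ?q_gt0.
  exists (tperm e f); last by right.
  by apply: contraNneq ef => /permP/(_ e); rewrite tpermL perm1 => ->.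
have CG_neq1 : 'C(monodromy_group D) != 1.
  apply: (cent_transitive_neq1 _ _ t) => // g Gg /(GN _ Gg) Ng.
  case: tN => [Nt|N1]; first exact: (centsP abN).
  by move: Ng; rewrite N1 => /set1P->; apply/commute_sym/commute1.
apply: contra CG_neq1 => /card_isog; rewrite cards1 => /eqP.
by rewrite -trivg_card1.
Qed.
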